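(* Let $(\mathfrak{g},\bullet,\langle\;,\;\rangle)$ be an $\mathrm{L}$-quadratic symmetric Leibniz algebra whose metric is Lorentzian. Then $(\mathfrak{g},\bullet,\langle\;,\;\rangle)$ is a quadratic Lie algebra.
   Context: Algebras are real and finite dimensional. A symmetric Leibniz algebra is both left Leibniz ($u\bullet(v\bullet w)=(u\bullet v)\bullet w+v\bullet(u\bullet w)$) and right Leibniz ($(v\bullet w)\bullet u=(v\bullet u)\bullet w+v\bullet(w\bullet u)$). A metric is a nondegenerate symmetric bilinear form; it is Lorentzian if it has signature $(n-1,1)$, $n=\dim\mathfrak{g}$. An algebra with a metric is $\mathrm{L}$-quadratic if every left multiplication $v\mapsto u\bullet v$ is skew-symmetric. A quadratic Lie algebra is a Lie algebra with a metric for which every $\mathrm{ad}_u$ is skew-symmetric. *)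

(* Defs.v *)
From mathcomp Require Import all_boot all_order all_algebra.
From mathcomp Require Import reals.

Set Implicit Arguments.
Unset Strict Implicit.
Unset Printing Implicit Defensive.

Import Order.TTheory GRing.Theory Num.Theory.
Local Open Scope ring_scope.

Section Algebras.
Variables (R : realType) (V : vectType R).
Implicit Types (m : {bilinear V -> V -> V}) (B : {symmetric V}).

Definition left_leibniz m : Prop :=
  forall u v w, m u (m v w) = m (m u v) w + m v (m u w).

Definition right_leibniz m : Prop :=
  forall u v w, m (m v w) u = m (m v u) w + m v (m w u).

Definition symmetric_leibniz m : Prop := left_leibniz m /\ right_leibniz m.

Definition is_lie m : Prop :=
  (forall u, m u u = 0) /\
  (forall u v w, m u (m v w) + m v (m w u) + m w (m u v) = 0).

Definition is_metric B : Prop := nondegenerate B.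

(* [f] is skew-symmetric with respect to [B]; [f] is only ever instantiated by
   linear maps. *)
Definition skew_adjoint B (f : V -> V) : Prop :=
  forall v w, B (f v) w = - B v (f w).

(* Every symmetric form over an ordered field has an orthogonal basis, and by
   Sylvester's law of inertia the two counts below do not depend on it; [p]
   counts the positive directions and [q] the negative ones. *)
Definition has_signature B (p q : nat) : Prop :=
  exists X : seq V,
    [/\ basis_of fullv X,
        forall i j, (i < size X)%N -> (j < size X)%N -> i != j ->
          B X`_i X`_j = 0,
        count (fun x => 0 < B x x) X = p
      & count (fun x => B x x < 0) X = q].

(* The truncated subtraction is harmless: a signature with [q = 1] forces
   [V] to be nonzero. *)
Definition lorentzian B : Prop := has_signature B (\dim {:V} - 1) 1.

Definition L_quadratic m B : Prop :=
  is_metric B /\ forall u, skew_adjoint B (m u).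

(* In a Lie algebra with bracket [m], the map [m u] is [ad_u]. *)
Definition quadratic_lie m B : Prop :=
  [/\ is_lie m, is_metric B & forall u, skew_adjoint B (m u)].

End Algebras.

(* Main.v *)
Require Import Defs.
From mathcomp Require Import all_boot all_order all_algebra.
From mathcomp Require Import reals.
Import Order.TTheory GRing.Theory Num.Theory.
Local Open Scope ring_scope.

(** Write [s u] for the square [m u u].  The point is that every square vanishes:
    then [m] is alternating, the left Leibniz identity becomes the Jacobi
    identity ([left_leibniz_alternating_lie]), and invariance of the metric is already
    part of the hypotheses.

    The left Leibniz identity gives [m (s u) v = 0], and the two identities
    together make a product anticommute with every vector
    ([leibniz_prod_anticomm]); hence [m v (s u) = 0] as well.  Moving [m v]
    across the skew-symmetric pairing, [s u] is orthogonal to every product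
    ([leibniz_square_orth_prod]).  So the squares are null vectors orthogonal to
    one another, and in Lorentzian signature such vectors all lie on a single
    line ([lorentzian_null_colinear]).

    Suppose [s u != 0].  Then [s x = c *: s u] for every [x], while
    skew-symmetry of [m x] gives [B (s x) x = 0]; therefore [s x = 0] as soon as
    [B (s u) x != 0].  By nondegeneracy some [v] pairs nontrivially with [s u],
    and since [B (s u) u = 0] the same holds of [u + v] and [u - v].  The squares
    of these three vectors vanish, and the parallelogram identity
    [s (u + v) + s (u - v) = s u *+ 2 + s v *+ 2] yields [s u = 0]. *)

Section LorentzianForms.
Set Implicit Arguments.
Unset Strict Implicit.
Variables (R : realType) (V : vectType R) (B : {symmetric V}).

Lemma form_sym u v : B u v = B v u.
Proof. by rewrite hermC expr0 mul1r. Qed.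

(** A basis-free form of the Lorentzian condition: the orthogonal complement of
    the single negative basis vector is spanned by the remaining basis vectors,
    which are all positive because the two counts exhaust the basis. *)
Lemma lorentzian_timelike : lorentzian B ->
  exists2 w, B w w < 0 & forall z, B z w = 0 -> z != 0 -> 0 < B z z.
Proof.
case=> X [basX0 orthX posX negX].
have basX : basis_of fullv (in_tuple X) by [].
have uniqX : uniq X := free_uniq (basis_free basX0).
have /hasP[w wX w_neg] : has (fun x => B x x < 0) X by rewrite has_count negX.
have sgnX : all (predU (fun x => 0 < B x x) (fun x => B x x < 0)) X.
  rewrite all_count.
  have := count_predUI (fun x => 0 < B x x) (fun x => B x x < 0) X.
  (* No vector is both positive and negative, so the two counts add up. *)
  rewrite (@eq_count _ (predI _ _) pred0) => [|x]; last first.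
    by apply/negP=> /andP[/lt_trans/[apply]]; rewrite ltxx.
  rewrite count_pred0 addn0 posX negX => ->; rewrite -(size_basis basX).
  by rewrite subnK // (size_basis basX) -negX count_size.
have pos_other x : x \in X -> x != w -> 0 < B x x.
  move=> xX x_neq_w; case/orP: (allP sgnX x xX) => // x_neg.
  (* A second negative vector would raise the negative count above one. *)
  suff: (1 < count (fun x => (B x x < 0)%R) X)%N by rewrite negX.
  rewrite (permP (perm_to_rem wX)) /= w_neg ltnS -has_count.
  by apply/hasP; exists x; rewrite // mem_rem_uniq // !inE x_neq_w.
exists w => // z zw0.
have defz : z = \sum_(i < size X) coord (in_tuple X) i z *: X`_i.
  by apply: (coord_basis basX); rewrite memvf.
set c := fun i => coord (in_tuple X) i z.
have BzX (j : 'I_(size X)) : B z X`_j = c j * B X`_j X`_j.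
  rewrite {1}defz linear_sumlz (bigD1 j) //= big1 => [|i neq_ij].
    by rewrite addr0 linearZl_LR.
  by rewrite linearZl_LR /= orthX ?mulr0.
have Bzz : B z z = \sum_(i < size X) c i ^+ 2 * B X`_i X`_i.
  rewrite {2}defz linear_sumr; apply: eq_bigr => i _.
  by rewrite linearZr_LR /= BzX mulrA -expr2.
have term_ge0 i : 0 <= c i ^+ 2 * B X`_i X`_i.
  case: (eqVneq X`_i w) => [eqw | neqw].
    move/eqP: (BzX i); rewrite eqw zw0 eq_sym mulf_eq0 (lt_eqF w_neg) orbF.
    by move=> /eqP->; rewrite expr0n mul0r.
  by rewrite mulr_ge0 ?sqr_ge0// ltW// pos_other// mem_nth.
(* If [B z z = 0], every nonnegative term vanishes, hence every coordinate. *)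
rewrite lt_def Bzz sumr_ge0 // andbT.
apply: contra_neq => /psumr_eq0P c0.
rewrite defz big1 // => i _; have /eqP := c0 (fun i _ => term_ge0 i) i isT.
rewrite mulf_eq0 sqrf_eq0 => /orP[/eqP ci0 | Xi0].
  by rewrite -/(c i) ci0 scale0r.
have Xi : X`_i \in X by rewrite mem_nth.
case: (eqVneq X`_i w) => [eqw | neqw].
  by rewrite eqw (lt_eqF w_neg) in Xi0.
by rewrite (gt_eqF (pos_other _ Xi neqw)) in Xi0.
Qed.

(** With [w] timelike, some combination of [e] and [f] is orthogonal to [w]; it
    is null too, and the form is definite on the complement of [w], so the
    combination is zero. *)
Lemma lorentzian_null_colinear e f : lorentzian B ->
  B e e = 0 -> B f f = 0 -> B e f = 0 -> e != 0 -> exists c, f = c *: e.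
Proof.
move=> /lorentzian_timelike[w _ posw] ee ff ef e0.
have ew : B e w != 0.
  by apply/eqP => /posw/(_ e0); rewrite ee ltxx.
exists (B f w / B e w); apply/eqP; rewrite -subr_eq0; apply/negPn/negP => /posw.
rewrite !(linearBl, linearBr, linearZl_LR, linearZr_LR) /=.
rewrite [B f e]form_sym ee ff ef !mulr0 !subr0 mulfVK // subrr ltxx.
by move/(_ erefl).
Qed.

Lemma nondegenerate_pairing u :
  nondegenerate B -> u != 0 -> exists v, B u v != 0.
Proof.
move=> /eqP rad0 u0; suff: u \notin orthov B fullv.
  by case/mem_orthovPn=> v _; exists v.
by rewrite rad0 memv0.
Qed.

End LorentzianForms.

Section SymmetricLeibniz.
Set Implicit Arguments.
Unset Strict Implicit.
Variables (R : realType) (V : vectType R) (m : {bilinear V -> V -> V}).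
Hypothesis left_m : left_leibniz m.

Lemma leibniz_square_mull u v : m (m u u) v = 0.
Proof.
by have /eqP := left_m u u v; rewrite -subr_eq subrr eq_sym => /eqP.
Qed.

(** Polarization makes [m] antisymmetric, and for an antisymmetric product the
    derivation property of [m u] is the Jacobi identity. *)
Lemma left_leibniz_alternating_lie : (forall u, m u u = 0) -> is_lie m.
Proof.
move=> alt; have anti u v : m v u = - m u v.
  apply/eqP; rewrite -addr_eq0 addrC.
  by have := alt (u + v); rewrite linearDl !linearDr /= !alt add0r addr0 => /eqP.
split=> // u v w; rewrite (left_m u v w).
rewrite (anti (m u v) w) (anti u w) linearNr /=.
by rewrite addrK subrr.
Qed.

Hypothesis right_m : right_leibniz m.

(** Both identities relate [m u (m w v)] and [m (m u w) v]; eliminating these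
    leaves only the two terms below. *)
Lemma leibniz_prod_anticomm u v w : m w (m u v) = - m (m u v) w.
Proof.
have /eqP := left_m u w v.
by rewrite (right_m v u w) addrAC -subr_eq subrr eq_sym addrC addr_eq0 => /eqP.
Qed.

Section Quadratic.
Variable B : {symmetric V}.
Hypothesis skewB : forall u, skew_adjoint B (m u).

(** A square is annihilated by all left multiplications, hence orthogonal to
    their images. *)
Lemma leibniz_square_orth_prod u v w : B (m u u) (m v w) = 0.
Proof.
have := skewB v (m u u) w.
rewrite leibniz_prod_anticomm leibniz_square_mull oppr0 linear0l.
by move/eqP; rewrite eq_sym oppr_eq0 => /eqP.
Qed.

Lemma square_orth_self u : B (m u u) u = 0.
Proof.
have /eqP := skewB u u u.
by rewrite [B u _]form_sym -addr_eq0 -mulr2n mulrn_eq0 => /eqP.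
Qed.

(** All squares lie on the line through a nonzero one, [m u u].  As [m x x] is
    orthogonal to [x], it is zero for every [x] off the hyperplane orthogonal to
    that line; [u] itself lies on this hyperplane, so it is reached as the
    midpoint of [u + v] and [u - v] with [v] off it. *)
Lemma lorentzian_squares_vanish :
  nondegenerate B -> lorentzian B -> forall u, m u u = 0.
Proof.
move=> ndB lorB u; apply/eqP/negPn/negP => sq_neq0.
have [v Buv] := nondegenerate_pairing ndB sq_neq0.
have sq0 x : B (m u u) x != 0 -> m x x = 0.
  move=> Bux.
  have [||| c sqx] :=
    lorentzian_null_colinear lorB _ (f := m x x) _ _ sq_neq0.
  - exact: leibniz_square_orth_prod.
  - exact: (leibniz_square_orth_prod x x x).
  - exact: leibniz_square_orth_prod.
  have /eqP := square_orth_self x.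
  rewrite sqx linearZl_LR /= mulf_eq0 (negPf Bux) orbF => /eqP->.
  by rewrite scale0r.
have eqD : m u u + (m u v + m v u) = 0.
  have : m (u + v) (u + v) = 0.
    by apply: sq0; rewrite linearDr /= square_orth_self add0r.
  by rewrite linearDl !linearDr /= (sq0 v Buv) addr0 addrA.
have eqB : m u u - (m u v + m v u) = 0.
  have : m (u - v) (u - v) = 0.
    by apply: sq0; rewrite linearBr /= square_orth_self sub0r oppr_eq0.
  rewrite linearBl !linearBr /= (sq0 v Buv) subr0 => <-.
  by rewrite opprD addrA.
have /eqP := congr2 +%R eqD eqB.
rewrite addrACA subrr !addr0 -mulr2n -scaler_nat scaler_eq0 pnatr_eq0 /=.
by rewrite (negPf sq_neq0).
Qed.

End Quadratic.
End SymmetricLeibniz.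

Theorem corollary6p3 (R : realType) (V : vectType R)
    (m : {bilinear V -> V -> V}) (B : {symmetric V})
    (hleib : symmetric_leibniz m) (hquad : L_quadratic m B)
    (hlor : lorentzian B) :
  quadratic_lie m B.
Proof.
case: hquad => ndB skewB; split=> //.
case: hleib => left_m right_m; apply: (left_leibniz_alternating_lie left_m).
exact: (lorentzian_squares_vanish left_m right_m skewB ndB hlor).
Qed.
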